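(* Let $R$ and $S$ be commutative noetherian rings, let $C$ be a semidualizing $R$-module, and let $R\to S$ be a flat ring homomorphism. Assume that $M$ is an $S$-module, and let $L$ be a proper $\mathcal{F}_{S\otimes_R C}$-resolution of $M$ over $S$. Then $L$ is a proper $\mathcal{F}_C$-resolution of $M$ over $R$.
   Context: A finitely generated module $C$ over a commutative noetherian ring $R$ is semidualizing if the homothety map $R\to\operatorname{Hom}_R(C,C)$ is an isomorphism and $\operatorname{Ext}^i_R(C,C)=0$ for all $i\geq 1$. If $R\to S$ is flat, then $S\otimes_R C$ is a semidualizing $S$-module. $\mathcal{F}_C(R)$ is the class of $R$-modules isomorphic to $F\otimes_R C$ with $F$ a flat $R$-module. A proper $\mathcal{F}_C$-resolution of $M$ over $R$ is a complex $X=(\cdots\to X_1\to X_0\to 0)$ with each $X_i\in\mathcal{F}_C(R)$ together with an augmentation $X_0\to M$ such that $X^+=(\cdots\to X_1\to X_0\to M\to 0)$ is a complex (not necessarily exact) and $\operatorname{Hom}_R(Y,X^+)$ is exact for all $Y\in\mathcal{F}_C(R)$; similarly over $S$ with $S\otimes_R C$. An $S$-module (or $S$-complex) is regarded as an $R$-module (or $R$-complex) by restriction of scalars along $R\to S$. *)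

(* Defs.v *)
From HB Require Import structures.
From mathcomp Require Import all_boot all_order all_algebra all_classical.

Set Implicit Arguments.
Unset Strict Implicit.
Unset Printing Implicit Defensive.

Import GRing.Theory.
Local Open Scope ring_scope.
Local Open Scope quotient_scope.
Local Open Scope classical_set_scope.

(* All rings are commutative with 1, the zero ring included (comPzRingType).
   Classically every type carries a choiceType structure, so lmodType R really
   ranges over all R-modules. *)

Lemma linear_ext (R : comPzRingType) (U V : lmodType R)
  (f g : {linear U -> V}) : f =1 g -> f = g.
Proof.
case: f g => [f [[cf1] [cf2]]] [g [[cg1] [cg2]]] /= /funext fg.
case: _ / fg in cg1 cg2 *.
by rewrite (Prop_irrelevance cf1 cg1) (Prop_irrelevance cf2 cg2).
Qed.

Section Hom.
Context (R : comPzRingType) (U V : lmodType R).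

Definition hom := {linear U -> V}.

HB.instance Definition _ := gen_eqMixin hom.
HB.instance Definition _ := gen_choiceMixin hom.

Definition hom_zero : hom := (\0 : {linear U -> V}).
Definition hom_opp (f : hom) : hom := (\- f : {linear U -> V}).
Definition hom_add (f g : hom) : hom := (f \+ g : {linear U -> V}).
Definition hom_scale (a : R) (f : hom) : hom := (a \*: f : {linear U -> V}).

Fact hom_addA : associative hom_add.
Proof. by move=> f g h; apply: linear_ext => x /=; rewrite addrA. Qed.
Fact hom_addC : commutative hom_add.
Proof. by move=> f g; apply: linear_ext => x /=; rewrite addrC. Qed.
Fact hom_add0 : left_id hom_zero hom_add.
Proof. by move=> f; apply: linear_ext => x /=; rewrite add0r. Qed.
Fact hom_addN : left_inverse hom_zero hom_opp hom_add.
Proof. by move=> f; apply: linear_ext => x /=; rewrite addNr. Qed.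

HB.instance Definition _ :=
  GRing.isZmodule.Build hom hom_addA hom_addC hom_add0 hom_addN.

Fact hom_scaleA a b f : hom_scale a (hom_scale b f) = hom_scale (a * b) f.
Proof. by apply: linear_ext => x /=; rewrite scalerA. Qed.
Fact hom_scale1 : left_id 1 hom_scale.
Proof. by move=> f; apply: linear_ext => x /=; rewrite scale1r. Qed.
Fact hom_scaleDr : right_distributive hom_scale +%R.
Proof. by move=> a f g; apply: linear_ext => x /=; rewrite scalerDr. Qed.
Fact hom_scaleDl f : {morph hom_scale^~ f : a b / a + b}.
Proof. by move=> a b; apply: linear_ext => x /=; rewrite scalerDl. Qed.

HB.instance Definition _ := GRing.Zmodule_isLmodule.Build R hom
  hom_scaleA hom_scale1 hom_scaleDr hom_scaleDl.

End Hom.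

Section HomFunctor.
Context (R : comPzRingType).

Definition postcomp (Y A B : lmodType R) (f : {linear A -> B})
  (u : hom Y A) : hom Y B := (f \o u : {linear Y -> B}).

Fact postcomp_linear (Y A B : lmodType R) (f : {linear A -> B}) :
  linear (@postcomp Y A B f).
Proof. by move=> a u v; apply: linear_ext => x /=; rewrite linearP. Qed.

HB.instance Definition _ (Y A B : lmodType R) (f : {linear A -> B}) :=
  GRing.isLinear.Build R (hom Y A) (hom Y B) *:%R (@postcomp Y A B f)
    (@postcomp_linear Y A B f).

Definition precomp (N A B : lmodType R) (f : {linear A -> B})
  (u : hom B N) : hom A N := (u \o f : {linear A -> N}).

Fact precomp_linear (N A B : lmodType R) (f : {linear A -> B}) :
  linear (@precomp N A B f).
Proof. by move=> a u v; apply: linear_ext. Qed.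

HB.instance Definition _ (N A B : lmodType R) (f : {linear A -> B}) :=
  GRing.isLinear.Build R (hom B N) (hom A N) *:%R (@precomp N A B f)
    (@precomp_linear N A B f).

End HomFunctor.

Section Tensor.
Context (R : comPzRingType) (M N : lmodType R).

(* A list [:: (m1, n1); ...; (mk, nk)] stands for the formal sum
   m1 (x) n1 + ... + mk (x) nk.  Formal sums only form a monoid, hence the
   relation 0 (x) n = 0 has to be imposed; opposites are then given by
   (- m) (x) n. *)
Inductive tensor_rel : seq (M * N) -> seq (M * N) -> Prop :=
| tensor_refl s : tensor_rel s s
| tensor_sym s t : tensor_rel s t -> tensor_rel t s
| tensor_trans s t u : tensor_rel s t -> tensor_rel t u -> tensor_rel s u
| tensor_cat s s' t t' :
    tensor_rel s s' -> tensor_rel t t' -> tensor_rel (s ++ t) (s' ++ t')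
| tensor_comm s t : tensor_rel (s ++ t) (t ++ s)
| tensor_zero n : tensor_rel [:: (0, n)] [::]
| tensor_addl m m' n : tensor_rel [:: (m + m', n)] [:: (m, n); (m', n)]
| tensor_addr m n n' : tensor_rel [:: (m, n + n')] [:: (m, n); (m, n')]
| tensor_balanced a m n : tensor_rel [:: (a *: m, n)] [:: (m, a *: n)].

Definition tensor_relb (s t : seq (M * N)) : bool := `[< tensor_rel s t >].

Fact tensor_relb_equiv : equiv_class_of tensor_relb.
Proof.
split; first by move=> s; apply/asboolP; exact: tensor_refl.
  by move=> s t; apply/asboolP/asboolP; exact: tensor_sym.
move=> t s u /asboolP st /asboolP tu; apply/asboolP.
exact: tensor_trans st tu.
Qed.

Canonical tensor_equiv := EquivRelPack tensor_relb_equiv.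

Definition tensor : Type := {eq_quot tensor_equiv}.

HB.instance Definition _ := Choice.on tensor.

Definition tsum (s : seq (M * N)) : tensor := \pi_{eq_quot tensor_equiv} s.
Definition trepr (x : tensor) : seq (M * N) := @repr _ {eq_quot tensor_equiv} x.

Lemma treprK : cancel trepr tsum.
Proof. exact: (@reprK _ {eq_quot tensor_equiv}). Qed.

Lemma tsumP s t : tsum s = tsum t <-> tensor_rel s t.
Proof.
split; first by move/eqquotP/asboolP.
by move=> st; apply/eqquotP/asboolP.
Qed.

Definition tensor_opp_seq (s : seq (M * N)) := [seq (- p.1, p.2) | p <- s].

Definition t_zero : tensor := tsum [::].
Definition t_add (x y : tensor) : tensor := tsum (trepr x ++ repr y).
Definition t_opp (x : tensor) : tensor := tsum (tensor_opp_seq (trepr x)).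

Lemma t_add_pi s t : t_add (tsum s) (tsum t) = tsum (s ++ t).
Proof.
by apply/tsumP/tensor_cat; apply/tsumP; rewrite treprK.
Qed.

Lemma tensor_oppl s : tensor_rel (tensor_opp_seq s ++ s) [::].
Proof.
elim: s => [|[m n] s IH]; first exact: tensor_refl.
apply: (@tensor_trans _ ([:: (- m, n)] ++ ([:: (m, n)] ++ (tensor_opp_seq s ++ s)))).
  apply: (tensor_cat (tensor_refl [:: (- m, n)])).
  have := tensor_cat (tensor_comm (tensor_opp_seq s) [:: (m, n)]) (tensor_refl s).
  by rewrite -!catA.
apply: (@tensor_trans _ ([:: (- m, n); (m, n)] ++ [::])).
  exact: (tensor_cat (tensor_refl [:: (- m, n); (m, n)]) IH).
apply: (tensor_trans (tensor_sym (tensor_addl _ _ _))).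
by rewrite addNr; exact: tensor_zero.
Qed.

Fact t_addA : associative t_add.
Proof.
move=> x y z; rewrite -[x]treprK -[y]treprK -[z]treprK.
by rewrite !t_add_pi catA.
Qed.
Fact t_addC : commutative t_add.
Proof.
move=> x y; rewrite -[x]treprK -[y]treprK !t_add_pi.
exact/tsumP/tensor_comm.
Qed.
Fact t_add0 : left_id t_zero t_add.
Proof. by move=> x; rewrite -[x]treprK /t_zero t_add_pi. Qed.
Fact t_addN : left_inverse t_zero t_opp t_add.
Proof.
move=> x; rewrite /t_opp -{2}[x]treprK t_add_pi.
exact/tsumP/tensor_oppl.
Qed.

HB.instance Definition _ :=
  GRing.isZmodule.Build tensor t_addA t_addC t_add0 t_addN.

Definition pure (m : M) (n : N) : tensor := tsum [:: (m, n)].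

Lemma tsumE s : tsum s = \sum_(p <- s) pure p.1 p.2.
Proof.
elim: s => [|[m n] s IH]; first by rewrite big_nil.
by rewrite big_cons -IH -[(m, n) :: s]/([:: (m, n)] ++ s) -t_add_pi.
Qed.

Lemma pureDl m m' n : pure (m + m') n = pure m n + pure m' n.
Proof.
rewrite [RHS]t_add_pi; exact/tsumP/tensor_addl.
Qed.

Lemma pureDr m n n' : pure m (n + n') = pure m n + pure m n'.
Proof.
rewrite [RHS]t_add_pi; exact/tsumP/tensor_addr.
Qed.

Lemma pureZ a m n : pure (a *: m) n = pure m (a *: n).
Proof. exact/tsumP/tensor_balanced. Qed.

Lemma tensor_ext (V : zmodType) (f g : {additive tensor -> V}) :
  (forall m n, f (pure m n) = g (pure m n)) -> f =1 g.
Proof.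
move=> fg x; rewrite -[x]treprK tsumE !raddf_sum.
by apply: eq_bigr => p _.
Qed.

Section Lift.
Context (V : zmodType) (b : M -> N -> V).

Definition balanced := [/\ forall m m' n, b (m + m') n = b m n + b m' n,
  forall m n n', b m (n + n') = b m n + b m n' &
  forall a m n, b (a *: m) n = b m (a *: n)].

Definition tensor_lift (x : tensor) : V := \sum_(p <- trepr x) b p.1 p.2.

Hypothesis bal : balanced.

Lemma tensor_rel_lift s t : tensor_rel s t ->
  \sum_(p <- s) b p.1 p.2 = \sum_(p <- t) b p.1 p.2.
Proof.
have [bDl bDr bZ] := bal.
elim=> //= {s t}; rewrite ?big_seq1 //=.
- by move=> s t u _ -> _ ->.
- by move=> s s' t t' _ es _ et; rewrite !big_cat /= es et.
- by move=> s t; rewrite !big_cat /= addrC.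
- move=> n; rewrite ?big_seq1 big_nil /=.
  by apply: (addrI (b 0 n)); rewrite -bDl !addr0.
- by move=> m m' n; rewrite ?big_cons ?big_nil ?addr0 /= ?bDl ?bDr.
- by move=> m n n'; rewrite ?big_cons ?big_nil ?addr0 /= ?bDl ?bDr.
- by move=> a m n; rewrite ?big_seq1 /= ?bZ.
Qed.

Lemma tensor_lift_pi s : tensor_lift (tsum s) = \sum_(p <- s) b p.1 p.2.
Proof. by apply/tensor_rel_lift/tsumP; rewrite treprK. Qed.

Lemma tensor_lift_pure m n : tensor_lift (pure m n) = b m n.
Proof. by rewrite tensor_lift_pi big_seq1. Qed.

Lemma tensor_lift_add : {morph tensor_lift : x y / x + y}.
Proof.
move=> x y; rewrite -[x]treprK -[y]treprK [tsum _ + _]t_add_pi.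
by rewrite !tensor_lift_pi big_cat.
Qed.

End Lift.
End Tensor.

Section TensorMap.
Context (R : comPzRingType).

Definition tensor_map (M M' N N' : lmodType R)
    (f : {linear M -> M'}) (g : {linear N -> N'}) : tensor M N -> tensor M' N' :=
  tensor_lift (fun m n => pure (f m) (g n)).

Section Theory.
Context (M M' N N' : lmodType R) (f : {linear M -> M'}) (g : {linear N -> N'}).

Lemma tensor_map_balanced : balanced (fun m n => pure (f m) (g n)).
Proof.
split=> [m m' n|m n n'|a m n]; rewrite ?linearD ?linearZ.
- exact: pureDl.
- exact: pureDr.
- exact: pureZ.
Qed.

Lemma tensor_map_pure m n : tensor_map f g (pure m n) = pure (f m) (g n).
Proof. exact: (tensor_lift_pure tensor_map_balanced). Qed.

Fact tensor_map_additive : zmod_morphism (tensor_map f g).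
Proof.
move=> x y; apply/eqP; rewrite eq_sym subr_eq; apply/eqP.
by rewrite -(tensor_lift_add tensor_map_balanced) subrK.
Qed.

HB.instance Definition _ := GRing.isZmodMorphism.Build
  (tensor M N) (tensor M' N') (tensor_map f g) tensor_map_additive.

End Theory.

Section Scale.
Context (M N : lmodType R).

(* Any linear f acts on tensor M N by f (x) id; this yields both the R-module
   structure below and that of the extension of scalars. *)
Definition tensor_actl (f : {linear M -> M}) : tensor M N -> tensor M N :=
  tensor_map f (idfun : {linear N -> N}).

HB.instance Definition _ f := GRing.Additive.on (tensor_actl f).

Lemma tensor_actl_pure f m n : tensor_actl f (pure m n) = pure (f m) n.
Proof. exact: tensor_map_pure. Qed.

Lemma tensor_actl_id (f : {linear M -> M}) x : f =1 id -> tensor_actl f x = x.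
Proof.
move=> f1; apply: (@tensor_ext _ _ _ _ _ (idfun : {additive _ -> _})) => m n.
by rewrite /= tensor_actl_pure f1.
Qed.

Lemma tensor_actl_comp (f g h : {linear M -> M}) x : h =1 f \o g ->
  tensor_actl f (tensor_actl g x) = tensor_actl h x.
Proof.
move=> hE.
apply: (@tensor_ext _ _ _ _ (tensor_actl f \o tensor_actl g)) => m n /=.
by rewrite !tensor_actl_pure hE.
Qed.

Lemma tensor_actl_add (f g h : {linear M -> M}) x : h =1 f \+ g ->
  tensor_actl h x = tensor_actl f x + tensor_actl g x.
Proof.
move=> hE.
apply: (@tensor_ext _ _ _ _ _ (tensor_actl f \+ tensor_actl g)) => m n /=.
by rewrite !tensor_actl_pure hE pureDl.
Qed.

Definition t_scale (a : R) : tensor M N -> tensor M N :=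
  tensor_actl (a \*: idfun : {linear M -> M}).

Fact t_scaleA a b x : t_scale a (t_scale b x) = t_scale (a * b) x.
Proof. by apply: tensor_actl_comp => m /=; rewrite scalerA. Qed.
Fact t_scale1 : left_id 1 t_scale.
Proof. by move=> x; apply: tensor_actl_id => m /=; rewrite scale1r. Qed.
Fact t_scaleDr : right_distributive t_scale +%R.
Proof. by move=> a; exact: raddfD. Qed.
Fact t_scaleDl x : {morph t_scale^~ x : a b / a + b}.
Proof. by move=> a b; apply: tensor_actl_add => m /=; rewrite scalerDl. Qed.

HB.instance Definition _ := GRing.Zmodule_isLmodule.Build R (tensor M N)
  t_scaleA t_scale1 t_scaleDr t_scaleDl.

Lemma scale_pure a (m : M) (n : N) : a *: pure m n = pure (a *: m) n.
Proof. exact: tensor_actl_pure. Qed.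

End Scale.

Fact tensor_map_scalable (M M' N N' : lmodType R)
  (f : {linear M -> M'}) (g : {linear N -> N'}) : scalable (tensor_map f g).
Proof.
move=> a x.
apply: (@tensor_ext _ _ _ _ (tensor_map f g \o ( *:%R a))
  (( *:%R a) \o tensor_map f g)) => m n /=.
by rewrite tensor_map_pure !scale_pure tensor_map_pure linearZ.
Qed.

HB.instance Definition _ (M M' N N' : lmodType R)
    (f : {linear M -> M'}) (g : {linear N -> N'}) :=
  GRing.isScalable.Build R (tensor M N) (tensor M' N') *:%R (tensor_map f g)
    (tensor_map_scalable f g).

End TensorMap.

(* phi only serves to select the R-module structure. *)
Definition restrict (R S : comPzRingType) (phi : {rmorphism R -> S})
  (M : lmodType S) : Type := M.

Section ChangeOfRings.
Context (R S : comPzRingType) (phi : {rmorphism R -> S}).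

Section Restrict.
Context (M : lmodType S).

HB.instance Definition _ := GRing.Zmodule.copy (restrict phi M) M.

Definition restrict_scale (a : R) (x : restrict phi M) : restrict phi M :=
  phi a *: (x : M).

Fact restrict_scaleA a b x :
  restrict_scale a (restrict_scale b x) = restrict_scale (a * b) x.
Proof. by rewrite /restrict_scale scalerA rmorphM. Qed.
Fact restrict_scale1 : left_id 1 restrict_scale.
Proof. by move=> x; rewrite /restrict_scale rmorph1 scale1r. Qed.
Fact restrict_scaleDr : right_distributive restrict_scale +%R.
Proof. by move=> a x y; exact: scalerDr. Qed.
Fact restrict_scaleDl x : {morph restrict_scale^~ x : a b / a + b}.
Proof. by move=> a b; rewrite /restrict_scale rmorphD scalerDl. Qed.

HB.instance Definition _ := GRing.Zmodule_isLmodule.Build R (restrict phi M)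
  restrict_scaleA restrict_scale1 restrict_scaleDr restrict_scaleDl.

End Restrict.

Definition restrict_map (M N : lmodType S) (f : {linear M -> N}) :
  restrict phi M -> restrict phi N := f.

Fact restrict_map_linear (M N : lmodType S) (f : {linear M -> N}) :
  linear (restrict_map f).
Proof. by move=> a x y; exact: (linearP f (phi a) x y). Qed.

HB.instance Definition _ (M N : lmodType S) (f : {linear M -> N}) :=
  GRing.isLinear.Build R (restrict phi M) (restrict phi N) *:%R (restrict_map f)
    (restrict_map_linear f).

(* S (x)_R C, with S acting on the left-hand factor *)
Definition extend (C : lmodType R) : Type := tensor (restrict phi S^o) C.

Section Extend.
Context (C : lmodType R).

HB.instance Definition _ := GRing.Zmodule.on (extend C).

Definition extend_scale (s : S) : extend C -> extend C :=
  tensor_actl (N := C) (restrict_map (s \*: idfun : {linear S^o -> S^o})).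

Fact extend_scaleA s t x :
  extend_scale s (extend_scale t x) = extend_scale (s * t) x.
Proof.
by apply: tensor_actl_comp => u; rewrite /= /restrict_map /= scalerA.
Qed.
Fact extend_scale1 : left_id 1 extend_scale.
Proof.
by move=> x; apply: tensor_actl_id => u; rewrite /= /restrict_map /= scale1r.
Qed.
Fact extend_scaleDr : right_distributive extend_scale +%R.
Proof. by move=> s; exact: raddfD. Qed.
Fact extend_scaleDl x : {morph extend_scale^~ x : s t / s + t}.
Proof.
by move=> s t; apply: tensor_actl_add => u; rewrite /= /restrict_map /= scalerDl.
Qed.

HB.instance Definition _ := GRing.Zmodule_isLmodule.Build S (extend C)
  extend_scaleA extend_scale1 extend_scaleDr extend_scaleDl.

Lemma extend_scale_pure (s t : S) (c : C) :
  s *: (pure (t : restrict phi S^o) c : extend C) = pure (s * t : restrict phi S^o) c.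
Proof. exact: tensor_actl_pure. Qed.

End Extend.
End ChangeOfRings.

Section ModuleProperties.
Context (R : comPzRingType).

Definition exact_at (A B D : lmodType R) (f : {linear A -> B})
    (g : {linear B -> D}) : Prop :=
  forall y, g y = 0 <-> exists x, f x = y.

Definition surjective (A B : lmodType R) (f : {linear A -> B}) : Prop :=
  forall y, exists x, f x = y.

Definition isomorphic (A B : lmodType R) : Prop :=
  exists f : {linear A -> B}, bijective f.

Definition flat (F : lmodType R) : Prop :=
  forall (A B D : lmodType R) (f : {linear A -> B}) (g : {linear B -> D}),
    exact_at f g ->
    exact_at (tensor_map (idfun : {linear F -> F}) f)
             (tensor_map (idfun : {linear F -> F}) g).

Definition projective (P : lmodType R) : Prop :=
  forall (A B : lmodType R) (g : {linear A -> B}) (f : {linear P -> B}),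
    surjective g -> exists h : {linear P -> A}, g \o h =1 f.

Definition finitely_generated (M : lmodType R) : Prop :=
  exists (n : nat) (e : 'I_n -> M),
    forall x, exists a : 'I_n -> R, x = \sum_i a i *: e i.

Definition ideal (I : set R) : Prop :=
  [/\ I 0, forall x y, I x -> I y -> I (x + y) & forall a x, I x -> I (a * x)].

Definition noetherian : Prop :=
  forall I : set R, ideal I -> exists (n : nat) (e : 'I_n -> R),
    (forall i, I (e i)) /\
    (forall x, I x -> exists a : 'I_n -> R, x = \sum_i a i * e i).

End ModuleProperties.

Definition flat_ring_hom (R S : comPzRingType) (phi : {rmorphism R -> S}) :
  Prop := flat (restrict phi S^o).

(* ... -> X_1 -> X_0 -> M -> 0, a complex which need not be exact *)
Record aug_complex (R : comPzRingType) (M : lmodType R) := AugComplex {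
  cx_obj :> nat -> lmodType R;
  cx_d : forall n, {linear cx_obj n.+1 -> cx_obj n};
  cx_aug : {linear cx_obj 0 -> M};
  cx_dd : forall n x, cx_d n (cx_d n.+1 x) = 0;
  cx_augd : forall x, cx_aug (cx_d 0 x) = 0
}.

Arguments cx_d {R M} X n : rename.
Arguments cx_aug {R M} X : rename.

Section Complexes.
Context (R : comPzRingType).

Definition acyclic (M : lmodType R) (X : aug_complex M) : Prop :=
  [/\ surjective (cx_aug X),
      exact_at (cx_d X 0) (cx_aug X) &
      forall n, exact_at (cx_d X n.+1) (cx_d X n)].

Section HomComplex.
Context (Y M : lmodType R) (X : aug_complex M).

Fact hom_complex_dd n (u : hom Y (X n.+2)) :
  postcomp (cx_d X n) (postcomp (cx_d X n.+1) u) = 0.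
Proof. by apply: linear_ext => y /=; exact: cx_dd. Qed.

Fact hom_complex_augd (u : hom Y (X 1)) :
  postcomp (cx_aug X) (postcomp (cx_d X 0) u) = 0.
Proof. by apply: linear_ext => y /=; exact: cx_augd. Qed.

Definition hom_complex : aug_complex (hom Y M) :=
  @AugComplex R (hom Y M) (fun n => hom Y (X n))
    (fun n => @postcomp R Y _ _ (cx_d X n)) (@postcomp R Y _ _ (cx_aug X))
    hom_complex_dd hom_complex_augd.

End HomComplex.

Definition projective_resolution (M : lmodType R) (P : aug_complex M) : Prop :=
  (forall n, projective (P n)) /\ acyclic P.

(* Ext^(n+1)(M, N) = 0: the cohomology of Hom(P, N) at Hom(P_(n+1), N) vanishes
   for some projective resolution P of M; by the comparison theorem this does
   not depend on P. *)
Definition ext_succ_vanishes (n : nat) (M N : lmodType R) : Prop :=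
  exists P : aug_complex M, projective_resolution P /\
    exact_at (@precomp R N _ _ (cx_d P n)) (@precomp R N _ _ (cx_d P n.+1)).

End Complexes.

Section RestrictComplex.
Context (R S : comPzRingType) (phi : {rmorphism R -> S}).
Context (M : lmodType S) (X : aug_complex M).

Definition restrict_complex : aug_complex (restrict phi M) :=
  @AugComplex R (restrict phi M) (fun n => restrict phi (X n))
    (fun n => @restrict_map R S phi _ _ (cx_d X n)) (@restrict_map R S phi _ _ (cx_aug X))
    (@cx_dd S M X) (@cx_augd S M X).

End RestrictComplex.

Section Semidualizing.
Context (R : comPzRingType) (C : lmodType R).

Definition homothety (a : R^o) : hom C C := (a \*: idfun : {linear C -> C}).

Fact homothety_linear : linear homothety.
Proof.
move=> a x y; apply: linear_ext => c /=.
by rewrite scalerDl scalerA.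
Qed.

HB.instance Definition _ := GRing.isLinear.Build R R^o (hom C C) *:%R
  homothety homothety_linear.

Definition semidualizing : Prop :=
  [/\ finitely_generated C, bijective homothety &
      forall n, ext_succ_vanishes n C C].

Definition FC (X : lmodType R) : Prop :=
  exists F : lmodType R, flat F /\ isomorphic X (tensor F C).

Definition proper_FC_resolution (M : lmodType R) (X : aug_complex M) : Prop :=
  (forall n, FC (X n)) /\
  (forall Y : lmodType R, FC Y -> acyclic (hom_complex Y X)).

End Semidualizing.

(* Main.v *)
From HB Require Import structures.
From mathcomp Require Import all_boot all_order all_algebra all_classical.
Require Import Defs.

Import GRing.Theory.
Set Implicit Arguments.
Unset Strict Implicit.
Unset Printing Implicit Defensive.
Local Open Scope ring_scope.

(** Everything rests on extension of scalars S (x)_R - being left adjoint to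
restriction along phi : R -> S, and on two resulting isomorphisms.

The complex Hom_R(Y, L^+) is, by the adjunction, isomorphic to
Hom_S(S (x)_R Y, L^+); this is how acyclicity passes from S to R
([acyclic_hom_restrict]).  It remains to see that the test modules and the terms
of the resolution correspond.

For an S-module M and an R-module A, cancelling S gives
M (x)_S (S (x)_R A) = M (x)_R A, naturally in both arguments
([tensor_insert_bij]).  Taking M = F and A = C, an S-module of the form
F (x)_S (S (x)_R C) restricts to F (x)_R C.  If F is flat over S and S is flat
over R, then F is flat over R, because F (x)_R - is the composite of the exact
functors S (x)_R - and F (x)_S - ([flat_restrict]).  So the terms of L lie in
F_C(R) ([FC_restrict]).

Conversely, let Y = F (x)_R C with F flat over R.  Base change commutes with
tensor products, so S (x)_R Y = (S (x)_R F) (x)_S (S (x)_R C)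
([extend_tensor_isomorphic]), and S (x)_R F is flat over S because tensoring an
S-module with it over S is tensoring with F over R ([flat_extend]).  So
S (x)_R Y is a legitimate test module over S ([FC_extend]).

The transpose of an R-linear map Y -> X into an S-module X is its extension
S (x)_R Y -> X; [extend_unit], which sends y to 1 (x) y, is the unit of the
adjunction, and most identities below are checked on its image. *)

(** * Exactness and isomorphisms *)

(** Exactness is invariant under isomorphism of three-term sequences.  The two
sequences may be over different rings and the comparison maps bare functions,
since the isomorphisms used below relate modules over R to modules over S;
on the last term only the preimage of 0 matters, so injectivity suffices. *)
Lemma exact_at_transfer (R R' : comPzRingType)
    (A B D : lmodType R) (A' B' D' : lmodType R')
    (f : {linear A -> B}) (g : {linear B -> D})
    (f' : {linear A' -> B'}) (g' : {linear B' -> D'})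
    (a : A -> A') (b : B -> B') (d : D -> D') :
  bijective a -> bijective b -> injective d -> d 0 = 0 ->
  (forall x, b (f x) = f' (a x)) -> (forall y, d (g y) = g' (b y)) ->
  exact_at f g <-> exact_at f' g'.
Proof.
move=> [a' aK a'K] [b' bK b'K] d_inj d0 bf dg.
have kerE y : g y = 0 <-> g' (b y) = 0.
  by rewrite -dg; split=> [->|] //; rewrite -d0; exact: d_inj.
have imE y : (exists x, f x = y) <-> (exists x', f' x' = b y).
  split=> [[x <-]|[x']]; first by exists (a x); rewrite bf.
  by rewrite -[x']a'K -bf => /(can_inj bK); exists (a' x').
split=> ex y; last by rewrite kerE imE; exact: ex.
by rewrite -[y]b'K -kerE -imE; exact: ex.
Qed.

Lemma isomorphic_sym (R : comPzRingType) (A B : lmodType R) :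
  isomorphic A B -> isomorphic B A.
Proof.
move=> [f [g fK gK]].
pose G : {linear B -> A} :=
  HB.pack g (GRing.isLinear.Build R B A *:%R g (can2_linear fK gK)).
by exists G; exists f.
Qed.

Lemma isomorphic_trans (R : comPzRingType) (A B D : lmodType R) :
  isomorphic A B -> isomorphic B D -> isomorphic A D.
Proof.
by move=> [f bf] [g bg]; exists (g \o f : {linear A -> D}); exact: bij_comp.
Qed.

(** * Linear maps on tensor products *)

Lemma tensor_lift_zmod_morphism (R : comPzRingType) (M N : lmodType R)
    (V : zmodType) (b : M -> N -> V) :
  balanced b -> zmod_morphism (tensor_lift b).
Proof.
move=> bal x y; apply/eqP; rewrite eq_sym subr_eq; apply/eqP.
by rewrite -(tensor_lift_add bal) subrK.
Qed.

Section TensorMaps.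
Context (R : comPzRingType) (M N : lmodType R).

Section Bilinear.
Context (V : lmodType R) (b : {linear M -> hom N V}).

(** A bilinear map is given in curried form, so that bilinearity is carried by
the types. *)
Definition tensor_bilift : tensor M N -> V := tensor_lift (fun m n => b m n).

Lemma bilinear_balanced : balanced (fun m n => b m n).
Proof.
split=> [m m' n|m n n'|a m n]; first by rewrite linearD.
  by rewrite linearD.
by rewrite !linearZ.
Qed.

Lemma tensor_bilift_pure m n : tensor_bilift (pure m n) = b m n.
Proof. exact: (tensor_lift_pure bilinear_balanced). Qed.

Fact tensor_bilift_additive : zmod_morphism tensor_bilift.
Proof. exact: tensor_lift_zmod_morphism bilinear_balanced. Qed.

HB.instance Definition _ := GRing.isZmodMorphism.Build
  (tensor M N) V tensor_bilift tensor_bilift_additive.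

Fact tensor_bilift_scalable : scalable tensor_bilift.
Proof.
move=> a x.
apply: (@tensor_ext _ _ _ _ (tensor_bilift \o ( *:%R a))
  (( *:%R a) \o tensor_bilift)) => m n /=.
by rewrite scale_pure !tensor_bilift_pure linearZ.
Qed.

HB.instance Definition _ := GRing.isScalable.Build R (tensor M N) V *:%R
  tensor_bilift tensor_bilift_scalable.

End Bilinear.

Definition pure_at (m : M) : N -> tensor M N := pure m.

Fact pure_at_linear m : linear (pure_at m).
Proof. by move=> a x y; rewrite /pure_at pureDr -pureZ scale_pure. Qed.

HB.instance Definition _ m :=
  GRing.isLinear.Build R N (tensor M N) *:%R (pure_at m) (pure_at_linear m).

End TensorMaps.

Section Swap.
Context (R : comPzRingType).

Definition pure_flip (M N : lmodType R) (n : N) : M -> tensor M N :=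
  fun m => pure m n.

Fact pure_flip_linear (M N : lmodType R) n : linear (@pure_flip M N n).
Proof. by move=> a x y; rewrite /pure_flip pureDl scale_pure. Qed.

HB.instance Definition _ (M N : lmodType R) n := GRing.isLinear.Build R M
  (tensor M N) *:%R (@pure_flip M N n) (@pure_flip_linear M N n).

Definition pure_flip_hom (M N : lmodType R) (n : N) : hom M (tensor M N) :=
  @pure_flip M N n.

Fact pure_flip_hom_linear (M N : lmodType R) : linear (@pure_flip_hom M N).
Proof.
move=> a x y; apply: linear_ext => m /=.
by rewrite /pure_flip pureDr scale_pure pureZ.
Qed.

HB.instance Definition _ (M N : lmodType R) := GRing.isLinear.Build R N
  (hom M (tensor M N)) *:%R (@pure_flip_hom M N) (@pure_flip_hom_linear M N).

Definition tensor_swap (M N : lmodType R) : {linear tensor M N -> tensor N M} :=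
  tensor_bilift (@pure_flip_hom N M).

Lemma tensor_swap_pure (M N : lmodType R) (m : M) (n : N) :
  tensor_swap M N (pure m n) = pure n m.
Proof. exact: tensor_bilift_pure. Qed.

Lemma tensor_swapK (M N : lmodType R) :
  cancel (tensor_swap M N) (tensor_swap N M).
Proof.
apply: (@tensor_ext _ _ _ _ (tensor_swap N M \o tensor_swap M N) idfun) => m n.
by rewrite /= !tensor_swap_pure.
Qed.

Lemma tensor_swap_bij (M N : lmodType R) : bijective (tensor_swap M N).
Proof. by exists (tensor_swap N M); exact: tensor_swapK. Qed.

Lemma tensor_swap_natural (M N N' : lmodType R) (f : {linear N -> N'}) x :
  tensor_swap _ _ (tensor_map f (idfun : {linear M -> M}) x) =
  tensor_map (idfun : {linear M -> M}) f (tensor_swap N M x).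
Proof.
apply: (@tensor_ext _ _ _ _ (tensor_swap _ _ \o tensor_map f idfun)
  (tensor_map idfun f \o tensor_swap N M)) => n m.
by rewrite /= tensor_map_pure !tensor_swap_pure tensor_map_pure.
Qed.

End Swap.

Section ChangeOfRings.
Context (R S : comPzRingType) (phi : {rmorphism R -> S}).

(** * The adjunction between extension and restriction of scalars *)

(** Since restrict phi M unfolds to M, the ring over which [restrict_map f] is
linear cannot be inferred from f; stating the type settles it. *)
Definition restrict_hom (M N : lmodType S) (f : {linear M -> N}) :
  hom (restrict phi M) (restrict phi N) := restrict_map f.

Section Adjunction.
Context (Y : lmodType R).

Definition extend_unit (y : Y) : restrict phi (extend phi Y) :=
  pure (1 : restrict phi S^o) y.

Fact extend_unit_linear : linear extend_unit.
Proof.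
move=> a x y; rewrite /extend_unit pureDr -pureZ; congr (_ + _).
rewrite -[RHS]/(phi a *: (pure (1 : restrict phi S^o) x : extend phi Y)).
by rewrite extend_scale_pure.
Qed.

HB.instance Definition _ := GRing.isLinear.Build R Y
  (restrict phi (extend phi Y)) *:%R extend_unit extend_unit_linear.

Lemma pure_extend (s : restrict phi S^o) (y : Y) :
  pure s y = (s : S) *: (extend_unit y : extend phi Y).
Proof. by rewrite extend_scale_pure mulr1. Qed.

(** For additive maps, agreement on the image of the unit is not enough: all of
its S-multiples are required. *)
Lemma extend_ext (X : zmodType) (f g : {additive extend phi Y -> X}) :
  (forall (s : S) y, f (s *: (extend_unit y : extend phi Y)) =
      g (s *: (extend_unit y : extend phi Y))) -> f =1 g.
Proof.
by move=> fg; apply: tensor_ext => s y; rewrite pure_extend.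
Qed.

Lemma extend_linear_ext (X : lmodType S) (f g : {linear extend phi Y -> X}) :
  (forall y, f (extend_unit y) = g (extend_unit y)) -> f =1 g.
Proof.
by move=> fg; apply: (@extend_ext _ f g) => s y /=; rewrite !linearZ /= fg.
Qed.

Section Transpose.
Context (X : lmodType S) (u : {linear Y -> restrict phi X}).

Definition transpose_fun : extend phi Y -> X :=
  tensor_lift (fun (s : restrict phi S^o) y => (s : S) *: (u y : X)).

Lemma transpose_balanced :
  balanced (fun (s : restrict phi S^o) y => (s : S) *: (u y : X)).
Proof.
split=> [s t y|s x y|a s y]; first exact: scalerDl.
  by rewrite linearD; exact: scalerDr.
rewrite linearZ.
rewrite -[LHS]/((phi a * (s : S)) *: (u y : X)).
by rewrite -[RHS]/((s : S) *: (phi a *: (u y : X))) scalerA mulrC.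
Qed.

Fact transpose_additive : zmod_morphism transpose_fun.
Proof. exact: tensor_lift_zmod_morphism transpose_balanced. Qed.

HB.instance Definition _ := GRing.isZmodMorphism.Build
  (extend phi Y) X transpose_fun transpose_additive.

Lemma transpose_pure (s : S) y :
  transpose_fun (s *: (extend_unit y : extend phi Y)) = s *: (u y : X).
Proof.
by rewrite -pure_extend; exact: (tensor_lift_pure transpose_balanced).
Qed.

Fact transpose_scalable : scalable transpose_fun.
Proof.
move=> a x.
apply: (@extend_ext _ (transpose_fun \o ( *:%R a))
  (( *:%R a) \o transpose_fun)) => s y /=.
by rewrite scalerA !transpose_pure scalerA.
Qed.

HB.instance Definition _ := GRing.isScalable.Build S (extend phi Y) X *:%R
  transpose_fun transpose_scalable.

Definition transpose : hom (extend phi Y) X := transpose_fun.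

Lemma transpose_unit y : transpose (extend_unit y) = u y.
Proof.
by have := transpose_pure 1 y; rewrite !scale1r.
Qed.

End Transpose.

(** The adjunction bijection Hom_S(S (x)_R Y, X) -> Hom_R(Y, X), in the
direction whose naturality and additivity hold by definition. *)
Definition untranspose (X : lmodType S) (v : hom (extend phi Y) X) :
  hom Y (restrict phi X) := (restrict_hom v \o extend_unit : {linear _ -> _}).

Lemma untranspose_bij (X : lmodType S) : bijective (@untranspose X).
Proof.
exists (@transpose X) => u; apply: linear_ext; last first.
  by move=> y; exact: transpose_unit.
by apply: extend_linear_ext => y; rewrite transpose_unit.
Qed.

End Adjunction.

Section Functor.
Context (A B : lmodType R) (f : {linear A -> B}).

Definition extend_map : hom (extend phi A) (extend phi B) :=
  transpose (@extend_unit B \o f : {linear A -> restrict phi (extend phi B)}).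

Lemma extend_map_unit a :
  extend_map (extend_unit a) = extend_unit (f a) :> extend phi B.
Proof. exact: transpose_unit. Qed.

(** Flatness of S over R speaks of the R-linear map id (x) f, whereas tensoring
over S afterwards needs an S-linear map; they are the same function. *)
Lemma extend_mapE : extend_map =1
  tensor_map (idfun : {linear restrict phi S^o -> restrict phi S^o}) f.
Proof.
apply: tensor_ext => s a /=.
by rewrite tensor_map_pure !pure_extend linearZ /= extend_map_unit.
Qed.

End Functor.

Lemma extend_isomorphic (A B : lmodType R) :
  isomorphic A B -> isomorphic (extend phi A) (extend phi B).
Proof.
move=> [f [g fK gK]].
pose G : {linear B -> A} :=
  HB.pack g (GRing.isLinear.Build R B A *:%R g (can2_linear fK gK)).
exists (extend_map f); exists (extend_map G).
  apply: (@extend_linear_ext _ _ (extend_map G \o extend_map f) idfun) => a /=.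
  by rewrite !extend_map_unit /= fK.
apply: (@extend_linear_ext _ _ (extend_map f \o extend_map G) idfun) => a /=.
by rewrite !extend_map_unit /= gK.
Qed.

(** * Cancelling the middle factor in a double tensor product *)

Section TensorExtend.
Context (M : lmodType S) (A : lmodType R).

Definition orbit_map (m : M) : S^o -> M := fun s => s *: m.

Fact orbit_map_linear m : linear (orbit_map m).
Proof. by move=> a x y; rewrite /orbit_map scalerDl scalerA. Qed.

HB.instance Definition _ m :=
  GRing.isLinear.Build S S^o M *:%R (orbit_map m) (orbit_map_linear m).

(** The pairing (m, s (x) a) |-> s m (x) a underlying the cancellation, obtained
by applying s |-> s m to the left factor. *)
Definition cancel_pairing (m : M) : extend phi A -> tensor (restrict phi M) A :=
  tensor_map (restrict_hom (orbit_map m)) (idfun : {linear A -> A}).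

Lemma cancel_pairing_pure m (s : S) a :
  cancel_pairing m (pure (s : restrict phi S^o) a) =
  pure (s *: m : restrict phi M) a.
Proof. exact: tensor_map_pure. Qed.

HB.instance Definition _ m := GRing.Additive.copy (cancel_pairing m)
   (tensor_map (restrict_hom (orbit_map m)) (idfun : {linear A -> A})).

Lemma cancel_balanced : balanced cancel_pairing.
Proof.
split=> [m m' x|m x y|s m x].
- apply: (@tensor_ext _ _ _ _ (cancel_pairing (m + m'))
    (cancel_pairing m \+ cancel_pairing m')) => s a /=.
  by rewrite !cancel_pairing_pure scalerDr -pureDl.
- exact: raddfD.
- apply: (@extend_ext _ _ (cancel_pairing (s *: m))
    (cancel_pairing m \o ( *:%R s : extend phi A -> extend phi A))) => t a /=.
  by rewrite scalerA -!pure_extend !cancel_pairing_pure scalerA mulrC.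
Qed.

(** Only the additivity of this map is established: its inverse [tensor_insert]
is linear by construction. *)
Definition tensor_cancel :
    tensor M (extend phi A) -> tensor (restrict phi M) A :=
  tensor_lift cancel_pairing.

Fact tensor_cancel_additive : zmod_morphism tensor_cancel.
Proof. exact: tensor_lift_zmod_morphism cancel_balanced. Qed.

HB.instance Definition _ := GRing.isZmodMorphism.Build
  (tensor M (extend phi A)) (tensor (restrict phi M) A)
  tensor_cancel tensor_cancel_additive.

Lemma tensor_cancel_pure m a :
  tensor_cancel (pure m (extend_unit a : extend phi A)) =
  pure (m : restrict phi M) a.
Proof.
rewrite /tensor_cancel (tensor_lift_pure cancel_balanced).
by rewrite cancel_pairing_pure scale1r.
Qed.

Definition tensor_insert_fun (m : restrict phi M) :
    hom A (restrict phi (tensor M (extend phi A))) :=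
  (restrict_hom (@pure_at S M (extend phi A) m) \o @extend_unit A
    : {linear A -> restrict phi (tensor M (extend phi A))}).

Fact tensor_insert_linear : linear tensor_insert_fun.
Proof.
move=> r m m'; apply: linear_ext => a.
rewrite /= /restrict_map /pure_at /= pureDl; congr (_ + _).
by rewrite -[LHS]/(pure (phi r *: (m : M)) _) -scale_pure.
Qed.

HB.instance Definition _ := GRing.isLinear.Build R (restrict phi M)
  (hom A (restrict phi (tensor M (extend phi A)))) *:%R
  tensor_insert_fun tensor_insert_linear.

Definition tensor_insert : {linear tensor (restrict phi M) A ->
  restrict phi (tensor M (extend phi A))} := tensor_bilift tensor_insert_fun.

Lemma tensor_insert_pure (m : restrict phi M) a :
  tensor_insert (pure m a) = pure (m : M) (extend_unit a : extend phi A).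
Proof. exact: tensor_bilift_pure. Qed.

Lemma tensor_insertK : cancel tensor_insert tensor_cancel.
Proof.
apply: (@tensor_ext _ _ _ _ (tensor_cancel \o tensor_insert) idfun) => m a.
by rewrite /= tensor_insert_pure tensor_cancel_pure.
Qed.

(** [tensor_insert] is only R-linear, so agreement of the additive maps has to be
tested on m (x) s (1 (x) a); balancing then moves s onto m. *)
Lemma tensor_cancelK : cancel tensor_cancel tensor_insert.
Proof.
(* The same map, with target no longer viewed as an R-module. *)
pose ti : {additive tensor (restrict phi M) A -> tensor M (extend phi A)} :=
  tensor_insert.
apply: (@tensor_ext _ _ _ _ (ti \o tensor_cancel) idfun) => m x.
apply: (@extend_ext _ _ (ti \o tensor_cancel \o @pure_at _ _ _ m)
  (@pure_at _ _ _ m)) => s a.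
by rewrite /= /pure_at -pureZ tensor_cancel_pure /ti tensor_insert_pure.
Qed.

Lemma tensor_insert_bij : bijective tensor_insert.
Proof.
by exists tensor_cancel; [exact: tensor_insertK | exact: tensor_cancelK].
Qed.

End TensorExtend.

Lemma tensor_insert_natural_l (M N : lmodType S) (A : lmodType R)
    (f : {linear M -> N}) x :
  @tensor_insert N A (tensor_map (restrict_hom f) (idfun : {linear A -> A}) x) =
  tensor_map f (idfun : {linear extend phi A -> extend phi A})
    (@tensor_insert M A x).
Proof.
pose fA := tensor_map f (idfun : {linear extend phi A -> extend phi A}).
apply: (@tensor_ext _ _ _ _
  (@tensor_insert N A \o tensor_map (restrict_hom f) (idfun : {linear A -> A}))
  (restrict_hom fA \o @tensor_insert M A)) => m a.
rewrite /= /restrict_map tensor_map_pure !tensor_insert_pure /fA.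
by rewrite tensor_map_pure.
Qed.

Lemma tensor_insert_natural_r (M : lmodType S) (A B : lmodType R)
    (f : {linear A -> B}) x :
  @tensor_insert M B
    (tensor_map (idfun : {linear restrict phi M -> restrict phi M}) f x) =
  tensor_map (idfun : {linear M -> M}) (extend_map f) (@tensor_insert M A x).
Proof.
pose Mf := tensor_map (idfun : {linear M -> M}) (extend_map f).
apply: (@tensor_ext _ _ _ _
  (@tensor_insert M B \o tensor_map idfun f)
  (restrict_hom Mf \o @tensor_insert M A)) => m a.
rewrite /= /restrict_map tensor_map_pure !tensor_insert_pure /Mf.
by rewrite tensor_map_pure extend_map_unit.
Qed.

(** * Flatness under change of rings *)

(** Up to the natural isomorphism [tensor_insert], tensoring over R with the
restriction of F is S (x)_R - followed by F (x)_S -. *)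
Lemma flat_restrict (F : lmodType S) :
  flat_ring_hom phi -> flat F -> flat (restrict phi F).
Proof.
move=> flatS flatF A B D f g /flatS exS.
have exE : exact_at (extend_map f) (extend_map g).
  by move=> y; rewrite extend_mapE exS; split=> -[x <-]; exists x;
    rewrite extend_mapE.
pose FE (X Y : lmodType R) (h : {linear X -> Y}) :=
  tensor_map (idfun : {linear F -> F}) (@extend_map X Y h).
have tr := exact_at_transfer (f' := FE _ _ f) (g' := FE _ _ g)
  (@tensor_insert_bij F A) (@tensor_insert_bij F B)
  (bij_inj (@tensor_insert_bij F D)) (raddf0 _)
  (tensor_insert_natural_r f) (tensor_insert_natural_r g).
by apply/tr/flatF.
Qed.

(** The isomorphism of F (x)_R X with (S (x)_R F) (x)_S X: it is
[tensor_insert], which concerns extended modules on the right, with both sides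
swapped. *)
Definition restrict_to_extend (F : lmodType R) (X : lmodType S) :
    tensor F (restrict phi X) -> tensor (extend phi F) X :=
  tensor_swap X (extend phi F) \o @tensor_insert X F \o
  tensor_swap F (restrict phi X).

Lemma restrict_to_extend_bij (F : lmodType R) (X : lmodType S) :
  bijective (@restrict_to_extend F X).
Proof.
apply: bij_comp (tensor_swap_bij _ _).
exact: bij_comp (tensor_swap_bij _ _) (@tensor_insert_bij X F).
Qed.

Lemma restrict_to_extend0 (F : lmodType R) (X : lmodType S) :
  @restrict_to_extend F X 0 = 0.
Proof. by rewrite /restrict_to_extend /= !raddf0. Qed.

Lemma restrict_to_extend_natural (F : lmodType R) (X Z : lmodType S)
    (f : {linear X -> Z}) x :
  restrict_to_extend (tensor_map (idfun : {linear F -> F}) (restrict_hom f) x) =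
  tensor_map (idfun : {linear extend phi F -> extend phi F}) f
    (restrict_to_extend x).
Proof.
rewrite /restrict_to_extend /= -tensor_swap_natural -tensor_insert_natural_l.
do 2!congr (_ _).
by rewrite -[in LHS](tensor_swapK x) -tensor_swap_natural tensor_swapK.
Qed.

(** An exact sequence of S-modules is exact over R, stays so under F (x)_R -,
and the result is the sequence tensored over S with S (x)_R F. *)
Lemma flat_extend (F : lmodType R) : flat F -> flat (extend phi F).
Proof.
move=> flatF A B D f g exfg.
have exR : exact_at (restrict_hom f) (restrict_hom g) by exact: exfg.
have [] // := exact_at_transfer
  (f := tensor_map (idfun : {linear F -> F}) (restrict_hom f))
  (g := tensor_map (idfun : {linear F -> F}) (restrict_hom g))
  (restrict_to_extend_bij F A) (restrict_to_extend_bij F B)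
  (bij_inj (restrict_to_extend_bij F D)) (restrict_to_extend0 F D)
  (restrict_to_extend_natural f) (restrict_to_extend_natural g).
by move=> + _; apply; exact: flatF.
Qed.

(** * Base change of a tensor product *)

Section ExtendTensor.
Context (F C : lmodType R).

Definition extend_split :
    hom (extend phi (tensor F C)) (tensor (extend phi F) (extend phi C)) :=
  transpose (@tensor_insert (extend phi F) C \o
    tensor_map (@extend_unit F) (idfun : {linear C -> C}) : {linear _ -> _}).

(** The curried form of (f, s (x) c) |-> s (x) (f (x) c).  Landing in an S-module
of homomorphisms, it extends to S (x)_R F by the adjunction, which produces the
bilinear map behind [extend_join]. *)
Definition extend_pure_at (f : F) :
    restrict phi (hom (extend phi C) (extend phi (tensor F C))) :=
  extend_map (@pure_at R F C f).

Fact extend_pure_at_linear : linear extend_pure_at.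
Proof.
move=> r f f'; apply/linear_ext/extend_linear_ext => c.
rewrite -[RHS]/(phi r *: extend_map (pure_at f) (extend_unit c) +
  extend_map (pure_at f') (extend_unit c)).
rewrite !extend_map_unit /= /pure_at pureDl -scale_pure.
exact: (linearP (@extend_unit (tensor F C))).
Qed.

HB.instance Definition _ := GRing.isLinear.Build R F
  (restrict phi (hom (extend phi C) (extend phi (tensor F C)))) *:%R
  extend_pure_at extend_pure_at_linear.

Definition extend_join :
    hom (tensor (extend phi F) (extend phi C)) (extend phi (tensor F C)) :=
  tensor_bilift (transpose extend_pure_at).

Lemma extend_split_pure f c :
  extend_split (extend_unit (pure f c)) =
  pure (extend_unit f : extend phi F) (extend_unit c : extend phi C).
Proof.
by rewrite /extend_split transpose_unit /= tensor_map_pure tensor_insert_pure.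
Qed.

Lemma extend_join_pure f c :
  extend_join (pure (extend_unit f : extend phi F)
    (extend_unit c : extend phi C)) = extend_unit (pure f c).
Proof.
rewrite /extend_join [LHS]tensor_bilift_pure transpose_unit.
exact: extend_map_unit.
Qed.

(** By S-linearity, both composites need testing only on 1 (x) (f (x) c) and
(1 (x) f) (x) (1 (x) c), which the two maps exchange. *)
Lemma extend_tensor_isomorphic :
  isomorphic (extend phi (tensor F C)) (tensor (extend phi F) (extend phi C)).
Proof.
exists extend_split; exists extend_join.
  pose k : {linear extend phi (tensor F C) -> _} := extend_join \o extend_split.
  apply: (@extend_linear_ext _ _ k idfun).
  apply: (@tensor_ext _ _ _ _ (restrict_hom k \o @extend_unit _)
    (@extend_unit _)) => f c /=.
  by rewrite /restrict_map /k /= extend_split_pure extend_join_pure.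
pose h : {linear tensor (extend phi F) (extend phi C) -> _} :=
  extend_split \o extend_join.
apply: (@tensor_ext _ _ _ _ h idfun) => x y /=.
apply: (@extend_linear_ext _ _ (h \o @pure_at _ _ _ x) (@pure_at _ _ _ x)) => c.
(* Now let the left factor vary, the right one being fixed to 1 (x) c. *)
pose flip := @pure_flip S (extend phi F) (extend phi C) (extend_unit c).
apply: (@extend_linear_ext _ _ (h \o flip) flip) => f.
by rewrite /= /flip /pure_flip /h /= extend_join_pure extend_split_pure.
Qed.

End ExtendTensor.

(** * Proper resolutions under restriction of scalars *)

Lemma FC_restrict (C : lmodType R) (X : lmodType S) :
  flat_ring_hom phi -> FC (extend phi C) X -> FC C (restrict phi X).
Proof.
move=> flatS [F [flatF [f bij_f]]].
exists (restrict phi F); split; first exact: flat_restrict.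
apply: (@isomorphic_trans _ _ (restrict phi (tensor F (extend phi C)))).
  by exists (restrict_hom f).
by apply: isomorphic_sym; exists (@tensor_insert F C); exact: tensor_insert_bij.
Qed.

Lemma FC_extend (C Y : lmodType R) : FC C Y -> FC (extend phi C) (extend phi Y).
Proof.
move=> [F [flatF YFC]]; exists (extend phi F); split; first exact: flat_extend.
apply: isomorphic_trans (extend_isomorphic YFC) _.
exact: extend_tensor_isomorphic.
Qed.

Lemma untranspose0 (Y : lmodType R) (X : lmodType S) :
  @untranspose Y X 0 = 0.
Proof. exact: linear_ext. Qed.

Lemma untranspose_natural (Y : lmodType R) (X Z : lmodType S)
    (f : {linear X -> Z}) (v : hom (extend phi Y) X) :
  untranspose (postcomp f v) = postcomp (restrict_hom f) (untranspose v).
Proof. exact: linear_ext. Qed.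

(** The adjunction identifies the two Hom complexes term by term. *)
Lemma acyclic_hom_restrict (Y : lmodType R) (M : lmodType S)
    (L : aug_complex M) :
  acyclic (hom_complex (extend phi Y) L) ->
  acyclic (hom_complex Y (restrict_complex phi L)).
Proof.
have tr (A B D : lmodType S) (f : {linear A -> B}) (g : {linear B -> D}) :
    exact_at (@postcomp _ (extend phi Y) _ _ f)
             (@postcomp _ (extend phi Y) _ _ g) ->
    exact_at (@postcomp _ Y _ _ (restrict_hom f))
             (@postcomp _ Y _ _ (restrict_hom g)).
  have [] // := exact_at_transfer
    (f' := @postcomp _ Y _ _ (restrict_hom f))
    (g' := @postcomp _ Y _ _ (restrict_hom g))
    (@untranspose_bij Y A) (@untranspose_bij Y B)
    (bij_inj (@untranspose_bij Y D)) (@untranspose0 Y D)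
    (@untranspose_natural _ _ _ f) (@untranspose_natural _ _ _ g).
move=> [aug_surj ex0 exS]; split=> [v||n].
- have [u uE] := aug_surj (transpose v).
  exists (untranspose u); apply: linear_ext => y.
  by rewrite -[RHS](transpose_unit v y) -uE.
- exact: tr ex0.
- exact: tr (exS n).
Qed.

End ChangeOfRings.

Theorem proposition2p5 (R S : comPzRingType) (phi : {rmorphism R -> S})
    (C : lmodType R) (M : lmodType S) (L : aug_complex M) :
  noetherian R -> noetherian S ->
  semidualizing C ->
  flat_ring_hom phi ->
  proper_FC_resolution (extend phi C) L ->
  proper_FC_resolution C (restrict_complex phi L).
Proof.
move=> _ _ _ flatS [L_FC L_proper]; split=> [n|Y Y_FC].
  exact: FC_restrict (L_FC n).
exact/acyclic_hom_restrict/L_proper/FC_extend.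
Qed.
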